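(* Let $A$ and $B$ be Gram matrices (real, of the same size) with all diagonal entries equal to $1$, and let $A*B$ be their Hadamard product. Then $$\sigma_{\min}(B)\le\sigma_{\min}(A*B)\le\sigma_{\max}(A*B)\le\sigma_{\max}(B).$$ If the matrix $B$ is positive definite, then $\kappa(A*B)\le\kappa(B)$.
   Context: The Hadamard product $A*B$ is the entry-wise product. A Gram matrix is a matrix of the form $(\langle v_i,v_j\rangle)_{i,j}$ for vectors $v_1,\dots,v_n$ in a Euclidean space. $\sigma_{\max}$ and $\sigma_{\min}$ denote the maximal and minimal (non-zero) singular values of a matrix, and $\kappa=\sigma_{\max}/\sigma_{\min}$ is the condition number.
   Formalization: Here σ_min is the smallest singular value, possibly 0, rather than the smallest non-zero one; with the non-zero reading the first inequality fails for A = I and B the all-ones matrix of size at least 2. The readings agree for nonsingular B. Matrices have size at least 1. *)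

(* Defs.v *)
From mathcomp Require Import all_boot all_order all_algebra.
From mathcomp Require Import boolp classical_sets reals.

Set Implicit Arguments.
Unset Strict Implicit.
Unset Printing Implicit Defensive.

Import Order.TTheory GRing.Theory Num.Theory.
Local Open Scope classical_set_scope.
Local Open Scope ring_scope.

Definition hadamard (R : realType) (m n : nat) (A B : 'M[R]_(m, n)) :
    'M[R]_(m, n) :=
  map2_mx *%R A B.

Definition inner (R : realType) (d : nat) (u v : 'rV[R]_d) : R :=
  (u *m v^T) 0 0.

(* Every Euclidean space is isometric to some R^d, and d is unrelated to n. *)
Definition gram_matrix (R : realType) (n : nat) (A : 'M[R]_n) : Prop :=
  exists (d : nat) (v : 'I_n -> 'rV[R]_d),
    A = \matrix_(i, j) inner (v i) (v j).

Definition positive_definite (R : realType) (n : nat) (A : 'M[R]_n) : Prop :=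
  A \is symmetricmx /\
  forall x : 'rV[R]_n, x != 0 -> 0 < (x *m A *m x^T) 0 0.

(* The singular values of A are the square roots of the eigenvalues of A^T A,
   here without multiplicities; 0 is one of them exactly when A is singular. *)
Definition singular_values (R : realType) (n : nat) (A : 'M[R]_n) : set R :=
  [set s | 0 <= s /\ eigenvalue (A^T *m A) (s ^+ 2)].

(* For n > 0 the set [singular_values A] is finite and nonempty, so that its
   supremum and infimum are its maximum and minimum. In particular
   [sigma_min A] is the smallest of all n singular values, and vanishes if A is
   singular; it is not the smallest nonzero one, for which
   sigma_min B <= sigma_min (A * B) fails with A = I and B the all-ones
   matrix of size n > 1. *)
Definition sigma_max (R : realType) (n : nat) (A : 'M[R]_n) : R :=
  sup (singular_values A).

Definition sigma_min (R : realType) (n : nat) (A : 'M[R]_n) : R :=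
  inf (singular_values A).

(* Meaningful for nonsingular A, that is when sigma_min A != 0. *)
Definition condition_number (R : realType) (n : nat) (A : 'M[R]_n) : R :=
  sigma_max A / sigma_min A.

(* Main.v *)
Require Import Defs.
From mathcomp Require Import all_boot all_order all_algebra.
From mathcomp Require Import boolp classical_sets reals.
From mathcomp Require Import ring lra.
Import Order.TTheory GRing.Theory Num.Theory.
Local Open Scope ring_scope.
Set Implicit Arguments.
Unset Strict Implicit.

(** The heart of the matter is an identity for quadratic forms. If [A] is the
    Gram matrix of vectors [v_i], then weighting [x] by the [k]-th coordinates
    of the [v_i] gives vectors [y_k = (x_i v_ik)_i] with
    [x (A * B) x^T = \sum_k y_k B y_k^T] (lemma [qform_hadamard_gram]), and
    [\sum_k |y_k|^2 = \sum_i x_i^2 A_ii], which is [|x|^2] since [A] has a unit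
    diagonal. Any bounds [m |y|^2 <= y B y^T <= M |y|^2] therefore pass from
    [B] to [A * B].

    It remains to show that the extreme singular values of a positive
    semidefinite matrix are the best such constants. For these matrices the
    singular values are the eigenvalues ([singular_values_psd]), and the best
    lower constant [m] of a symmetric matrix [S] is an eigenvalue
    ([rayleigh_min]). The latter needs neither diagonalization nor
    compactness: [S - m] is positive semidefinite, and if it were invertible
    it would be bounded below by a positive multiple of the identity
    ([psd_unit_coercive]), so that [m] could be increased. The upper constant
    is obtained from [- S]. *)

(** * Quadratic forms *)

Definition qform {R : realType} {n : nat} (M : 'M[R]_n) (x : 'rV[R]_n) : R :=
  (x *m M *m x^T) 0 0.

Lemma innerE (R : realType) (n : nat) (u v : 'rV[R]_n) :
  inner u v = \sum_i u 0 i * v 0 i.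
Proof. by rewrite /inner mxE; apply: eq_bigr => i _; rewrite mxE. Qed.

Lemma inner_ge0 (R : realType) (n : nat) (x : 'rV[R]_n) : 0 <= inner x x.
Proof. by rewrite innerE sumr_ge0 // => i _; rewrite -expr2 sqr_ge0. Qed.

Lemma inner_eq0 (R : realType) (n : nat) (x : 'rV[R]_n) :
  (inner x x == 0) = (x == 0).
Proof.
apply/eqP/eqP => [|->]; last by rewrite /inner mul0mx mxE.
rewrite innerE => x0; apply/rowP => i; rewrite mxE.
have /psumr_eq0P/(_ x0)/(_ i isT)/eqP : forall j, true -> 0 <= x 0 j * x 0 j.
  by move=> j _; rewrite -expr2 sqr_ge0.
by rewrite -expr2 sqrf_eq0 => /eqP.
Qed.

Lemma inner_gt0 (R : realType) (n : nat) (x : 'rV[R]_n) :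
  x != 0 -> 0 < inner x x.
Proof. by move=> x0; rewrite lt_def inner_ge0 inner_eq0 x0. Qed.

Lemma qformE (R : realType) (n : nat) (M : 'M[R]_n) (x : 'rV[R]_n) :
  qform M x = \sum_i \sum_j x 0 i * x 0 j * M i j.
Proof.
rewrite /qform mxE exchange_big; apply: eq_bigr => j _.
rewrite !mxE mulr_suml; apply: eq_bigr => i _; ring.
Qed.

Lemma qformN (R : realType) (n : nat) (M : 'M[R]_n) (x : 'rV[R]_n) :
  qform (- M) x = - qform M x.
Proof. by rewrite /qform mulmxN mulNmx mxE. Qed.

Lemma qform_sub_scalar (R : realType) (n : nat) (M : 'M[R]_n) (a : R)
    (x : 'rV[R]_n) :
  qform (M - a%:M) x = qform M x - a * inner x x.
Proof.
by rewrite /qform /inner mulmxBr mulmxBl mul_mx_scalar -scalemxAl !mxE.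
Qed.

Lemma qform_eigenvector (R : realType) (n : nat) (M : 'M[R]_n) (a : R)
    (v : 'rV[R]_n) :
  v *m M = a *: v -> qform M v = a * inner v v.
Proof. by rewrite /qform => ->; rewrite -scalemxAl mxE. Qed.

Lemma qform_le_inner (R : realType) (n : nat) (M : 'M[R]_n) :
  exists2 C : R, 0 < C & forall x, qform M x <= C * inner x x.
Proof.
(* The 1 makes the constant positive even if [M = 0]. *)
exists (1 + \sum_i \sum_j `|M i j|) => [|x].
  by rewrite ltr_pwDl // sumr_ge0 // => i _; rewrite sumr_ge0.
have coord_le i : `|x 0 i| ^+ 2 <= inner x x.
  rewrite real_normK ?num_real // innerE (bigD1 i) //= -expr2 lerDl.
  by rewrite sumr_ge0 // => j _; rewrite -expr2 sqr_ge0.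
apply: (@le_trans _ _ ((\sum_i \sum_j `|M i j|) * inner x x)); last first.
  by rewrite mulrDl mul1r lerDr inner_ge0.
rewrite qformE mulr_suml ler_sum // => i _; rewrite mulr_suml ler_sum // => j _.
(* [|x_i| |x_j| <= (|x_i|^2 + |x_j|^2) / 2 <= |x|^2] *)
apply: (le_trans (ler_norm _)); rewrite !normrM mulrC ler_wpM2l //.
have := coord_le i; have := coord_le j.
have := sqr_ge0 (`|x 0 i| - `|x 0 j|); nra.
Qed.

(** * The Rayleigh minimum of a symmetric matrix *)

(** Put [y = x N^-1], so that the polarized form of [N] takes the value [|x|^2]
    at [(y, x)]. If [qform N^-1 x <= C * |x|^2], then expanding
    [0 <= qform N (y - C x)] gives [|x|^2 <= C * qform N x]. *)
Lemma psd_unit_coercive (R : realType) (n : nat) (N : 'M[R]_n) :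
  N^T = N -> (forall x, 0 <= qform N x) -> N \in unitmx ->
  exists2 c : R, 0 < c & forall x, c * inner x x <= qform N x.
Proof.
move=> Nsym Npsd Nunit; have [C C0 leC] := qform_le_inner (invmx N).
exists C^-1 => [|x]; first by rewrite invr_gt0.
rewrite ler_pdivrMl //.
have /(_ (x *m invmx N - C *: x)) := Npsd.
have -> : qform N (x *m invmx N - C *: x) =
    qform (invmx N) x - 2 * C * inner x x + C ^+ 2 * qform N x.
  rewrite /qform /inner [(_ - _)^T]linearB /= [(C *: x)^T]linearZ /=.
  rewrite trmx_mul trmx_inv Nsym.
  rewrite mulmxBl mulmxKV // -scalemxAl mulmxBr !mulmxBl -!scalemxAr -!scalemxAl.
  by rewrite !mulmxA (mulmxK Nunit) !mxE; ring.
have := leC x; move: (qform _ x) (qform _ x) (inner x x) => a b p.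
move=> H1 H2; rewrite -(ler_pM2l C0); nra.
Qed.

(** Take for [m] the supremum of the constants [t] with
    [t * |x|^2 <= qform M x] for all [x]. Were [M - m] invertible, it would be
    coercive, and some [m + c] with [c > 0] would be admissible as well. *)
Lemma rayleigh_min (R : realType) (n : nat) (M : 'M[R]_n) :
  (0 < n)%N -> M^T = M ->
  exists2 m : R, eigenvalue M m & forall x, m * inner x x <= qform M x.
Proof.
move=> n0 Msym.
pose E : set R := [set t | forall x, t * inner x x <= qform M x]%classic.
have E_ub x : x != 0 -> ubound E (qform M x / inner x x).
  by move=> x0 t /(_ x); rewrite ler_pdivlMr // inner_gt0.
have E_sup : has_sup E.
  split.
    have [C _ leC] := qform_le_inner (- M).
    by exists (- C) => x; rewrite mulNr lerNl -qformN.
  have x0 : const_mx 1 != 0 :> 'rV[R]_n.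
    by apply/eqP => /rowP/(_ (Ordinal n0)); rewrite !mxE => /eqP; rewrite oner_eq0.
  by eexists; exact: E_ub x0.
have supE : E (sup E).
  move=> x; have [->|x0] := eqVneq x 0.
    by rewrite /qform /inner !mul0mx mxE mulr0.
  by rewrite -ler_pdivlMr ?inner_gt0 // ge_sup //; [case: E_sup | exact: E_ub].
exists (sup E) => //; apply: contraT.
rewrite /eigenvalue /eigenspace /= negbK kermx_eq0 row_free_unit => unitN.
have Nsym : (M - (sup E)%:M)^T = M - (sup E)%:M.
  by rewrite linearB /= Msym tr_scalar_mx.
have [x|c c0 lec] := psd_unit_coercive Nsym _ unitN.
  by rewrite qform_sub_scalar subr_ge0.
have : E (sup E + c).
  by move=> x; have := lec x; rewrite qform_sub_scalar mulrDl; lra.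
by move=> /(ub_le_sup (proj2 E_sup)); rewrite gerDl leNgt c0.
Qed.

(** * Extreme singular values of positive semidefinite matrices *)

(** Factor [M^2 - s^2 = (M - s) (M + s)]: for [s > 0] the second factor has a
    trivial kernel, because [M] has no negative eigenvalue. For [s = 0],
    [v M^2 = 0] gives [|v M|^2 = 0]. *)
Lemma singular_values_psd (R : realType) (n : nat) (M : 'M[R]_n) (s : R) :
  M^T = M -> (forall x, 0 <= qform M x) ->
  singular_values M s <-> 0 <= s /\ eigenvalue M s.
Proof.
move=> Msym Mpsd; rewrite /singular_values /= Msym.
split=> -[s0 /eigenvalueP[v vM v0]]; split=> //; apply/eigenvalueP; last first.
  by exists v => //; rewrite mulmxA vM -scalemxAl vM scalerA.
exists v => //; have [s_eq0|s_neq0] := eqVneq s 0.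
  rewrite s_eq0 scale0r; apply/eqP; rewrite -inner_eq0 /inner trmx_mul Msym.
  by rewrite -mulmxA (mulmxA M) mulmxA vM s_eq0 expr0n scale0r mul0mx mxE.
apply/eqP; rewrite -subr_eq0; apply/eqP; set w := _ - _.
have wM : w *m M = (- s) *: w.
  rewrite /w mulmxBl -mulmxA vM -scalemxAl scalerBr scalerA.
  by rewrite !scaleNr mulNr -expr2 scaleNr opprK addrC.
apply/eqP/negPn/negP => w0.
have := Mpsd w; rewrite (qform_eigenvector wM) leNgt.
by rewrite nmulr_rlt0 ?inner_gt0 // oppr_lt0 lt_def s_neq0 s0.
Qed.

Lemma sigma_min_psd (R : realType) (n : nat) (M : 'M[R]_n) :
  (0 < n)%N -> M^T = M -> (forall x, 0 <= qform M x) ->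
  [/\ 0 <= sigma_min M, eigenvalue M (sigma_min M)
    & forall x, sigma_min M * inner x x <= qform M x].
Proof.
move=> n0 Msym Mpsd; have [m m_eig m_le] := rayleigh_min n0 Msym.
have m_lb a : eigenvalue M a -> m <= a.
  move=> /eigenvalueP[v vM v0]; have := m_le v.
  by rewrite (qform_eigenvector vM) ler_pM2r // inner_gt0.
have m0 : 0 <= m.
  have /eigenvalueP[v vM v0] := m_eig; have := Mpsd v.
  by rewrite (qform_eigenvector vM) pmulr_lge0 // inner_gt0.
have sv_m : singular_values M m by apply/singular_values_psd.
have lb_m : lbound (singular_values M) m.
  by move=> a /(singular_values_psd _ Msym Mpsd)[_]; exact: m_lb.
suff -> : sigma_min M = m by split.
apply/eqP; rewrite eq_le /sigma_min ge_inf //; last by exists m.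
by rewrite lb_le_inf //; exists m.
Qed.

Lemma sigma_max_psd (R : realType) (n : nat) (M : 'M[R]_n) :
  (0 < n)%N -> M^T = M -> (forall x, 0 <= qform M x) ->
  eigenvalue M (sigma_max M) /\
  forall x, qform M x <= sigma_max M * inner x x.
Proof.
move=> n0 Msym Mpsd.
have [|m /eigenvalueP[u uM u0] m_le] := rayleigh_min (M := - M) n0.
  by rewrite linearN /= Msym.
have Mm_le x : qform M x <= - m * inner x x.
  by rewrite mulNr lerNr -qformN.
have Mm_eig : eigenvalue M (- m).
  by apply/eigenvalueP; exists u => //; rewrite scaleNr -uM mulmxN opprK.
have m_ub a : eigenvalue M a -> a <= - m.
  move=> /eigenvalueP[v vM v0]; have := Mm_le v.
  by rewrite (qform_eigenvector vM) ler_pM2r // inner_gt0.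
have m0 : 0 <= - m.
  by have := le_trans (Mpsd u) (Mm_le u); rewrite pmulr_lge0 // inner_gt0.
have sv_m : singular_values M (- m) by apply/singular_values_psd.
have ub_m : ubound (singular_values M) (- m).
  by move=> a /(singular_values_psd _ Msym Mpsd)[_]; exact: m_ub.
suff -> : sigma_max M = - m by split.
apply/eqP; rewrite eq_le /sigma_max ge_sup //=; last by exists (- m).
by rewrite ub_le_sup //; exists (- m).
Qed.

(** * Hadamard products with Gram matrices *)

Lemma gram_matrix_sym (R : realType) (n : nat) (A : 'M[R]_n) :
  gram_matrix A -> A^T = A.
Proof.
move=> [d [v ->]]; apply/matrixP => i j; rewrite !mxE !innerE.
by apply: eq_bigr => k _; rewrite mulrC.
Qed.

Lemma qform_hadamard_gram (R : realType) (n d : nat) (v : 'I_n -> 'rV[R]_d)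
    (B : 'M[R]_n) (x : 'rV[R]_n) :
  qform (hadamard (\matrix_(i, j) inner (v i) (v j)) B) x =
  \sum_k qform B (\row_i (x 0 i * v i 0 k)).
Proof.
under [RHS]eq_bigr do rewrite qformE.
rewrite qformE [RHS]exchange_big; apply: eq_bigr => i _.
rewrite [RHS]exchange_big; apply: eq_bigr => j _.
rewrite !mxE innerE mulr_suml mulr_sumr; apply: eq_bigr => k _.
by rewrite !mxE; ring.
Qed.

Lemma sum_inner_weighted (R : realType) (n d : nat) (v : 'I_n -> 'rV[R]_d)
    (x : 'rV[R]_n) :
  (forall i, inner (v i) (v i) = 1) ->
  \sum_k inner (\row_i (x 0 i * v i 0 k)) (\row_i (x 0 i * v i 0 k)) =
  inner x x.
Proof.
move=> v1; under eq_bigr do rewrite innerE.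
rewrite exchange_big innerE; apply: eq_bigr => i _.
rewrite -[RHS]mulr1 -(v1 i) innerE mulr_sumr; apply: eq_bigr => k _.
by rewrite !mxE; ring.
Qed.

(** The all-ones matrix is the identity for the Hadamard product, so positivity
    of a Gram matrix is a case of [qform_hadamard_gram]: the form of the all-ones
    matrix is the square of the sum of the coordinates. *)
Lemma gram_matrix_psd (R : realType) (n : nat) (A : 'M[R]_n) (x : 'rV[R]_n) :
  gram_matrix A -> 0 <= qform A x.
Proof.
move=> [d [v ->]]; set G := \matrix_(i, j) _.
have -> : G = hadamard G (const_mx 1) by apply/matrixP => i j; rewrite !mxE mulr1.
rewrite qform_hadamard_gram sumr_ge0 // => k _; rewrite qformE.
under eq_bigr do under eq_bigr do rewrite [const_mx _ _ _]mxE mulr1.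
by under eq_bigr do rewrite -mulr_sumr; rewrite -mulr_suml -expr2 sqr_ge0.
Qed.

Lemma hadamard_sym (R : realType) (n : nat) (A B : 'M[R]_n) :
  A^T = A -> B^T = B -> (hadamard A B)^T = hadamard A B.
Proof.
by move=> As Bs; apply/matrixP => i j; rewrite -{2}As -{2}Bs !mxE.
Qed.

Lemma qform_hadamard_ge (R : realType) (n : nat) (A B : 'M[R]_n) (m : R) :
  gram_matrix A -> (forall i, A i i = 1) ->
  (forall y, m * inner y y <= qform B y) ->
  forall x, m * inner x x <= qform (hadamard A B) x.
Proof.
move=> [d [v ->]] A1 mB x.
rewrite qform_hadamard_gram -(@sum_inner_weighted _ _ _ v) => [|i].
  by rewrite mulr_sumr ler_sum.
by have := A1 i; rewrite mxE.
Qed.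

Lemma qform_hadamard_le (R : realType) (n : nat) (A B : 'M[R]_n) (m : R) :
  gram_matrix A -> (forall i, A i i = 1) ->
  (forall y, qform B y <= m * inner y y) ->
  forall x, qform (hadamard A B) x <= m * inner x x.
Proof.
move=> [d [v ->]] A1 mB x.
rewrite qform_hadamard_gram -(@sum_inner_weighted _ _ _ v) => [|i].
  by rewrite mulr_sumr ler_sum.
by have := A1 i; rewrite mxE.
Qed.

Unset Implicit Arguments.
Set Strict Implicit.

Theorem lemma1 (R : realType) (n : nat) (A B : 'M[R]_n) (hn : (0 < n)%N)
    (gramA : gram_matrix A) (gramB : gram_matrix B)
    (diagA : forall i : 'I_n, A i i = 1) (diagB : forall i : 'I_n, B i i = 1) :
  [/\ sigma_min B <= sigma_min (hadamard A B),
      sigma_min (hadamard A B) <= sigma_max (hadamard A B)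
    & sigma_max (hadamard A B) <= sigma_max B] /\
  (positive_definite B ->
     condition_number (hadamard A B) <= condition_number B).
Proof.
have Bsym := gram_matrix_sym gramB.
have Bpsd x := gram_matrix_psd x gramB.
have [_ minB_eig minB_le] := sigma_min_psd hn Bsym Bpsd.
have [_ maxB_ge] := sigma_max_psd hn Bsym Bpsd.
have Hsym := hadamard_sym (gram_matrix_sym gramA) Bsym.
have Hpsd x : 0 <= qform (hadamard A B) x.
  rewrite -(mul0r (inner x x)); apply: qform_hadamard_ge => // y.
  by rewrite mul0r.
have [minH0 /eigenvalueP[u uH u0] minH_le] := sigma_min_psd hn Hsym Hpsd.
have [/eigenvalueP[w wH w0] maxH_ge] := sigma_max_psd hn Hsym Hpsd.
have min_le : sigma_min B <= sigma_min (hadamard A B).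
  (* An eigenvector [u] for the least eigenvalue of [A * B] attains the form. *)
  rewrite -(ler_pM2r (inner_gt0 u0)) -(qform_eigenvector uH).
  exact: qform_hadamard_ge.
have mid_le : sigma_min (hadamard A B) <= sigma_max (hadamard A B).
  rewrite -(ler_pM2r (inner_gt0 u0)).
  exact: le_trans (minH_le u) (maxH_ge u).
have max_le : sigma_max (hadamard A B) <= sigma_max B.
  rewrite -(ler_pM2r (inner_gt0 w0)) -(qform_eigenvector wH).
  exact: qform_hadamard_le.
split=> // -[_ Bpd].
have minB0 : 0 < sigma_min B.
  have /eigenvalueP[v vB v0] := minB_eig; have := Bpd v v0.
  rewrite -/(qform B v) (qform_eigenvector vB).
  by rewrite pmulr_lgt0 // inner_gt0.
rewrite /condition_number ler_pM ?invr_ge0 //; first exact: le_trans mid_le.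
by rewrite lef_pV2 // posrE (lt_le_trans minB0).
Qed.
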